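(* For $h>0$, let $v(t,h)$ be the fundamental solution of the linear delay differential equation $$x'(t)=-x(t)-x(t-h).$$ Then, for every $\alpha>2$, there exist $h_0=h_0(\alpha)>0$ and $c=c(\alpha)>0$ such that $$|v(t,h)|\le c\,h\exp\left(-\frac{\pi^2 t}{\alpha h^3}\right),\qquad t\ge 0,$$ for all $h\ge h_0$.
   Context: The fundamental solution $v(\cdot,h):[-h,+\infty)\to\mathbb{R}$ is the solution of $x'(t)=-x(t)-x(t-h)$ (for $t\ge 0$) satisfying $v(0,h)=1$ and $v(s,h)=0$ for all $s\in[-h,0)$. *)

(* Defs.v *)
From Stdlib Require Import Reals.
From Coquelicot Require Import Coquelicot.

Open Scope R_scope.

Definition is_right_derive (f : R -> R) (t l : R) : Prop :=
  filterlim (fun s => (f s - f t) / (s - t)) (at_right t) (locally l).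

(* The fundamental solution of x'(t) = - x(t) - x(t - h) lives on [-h, +oo);
   the values of x on (-oo, -h) are unconstrained and irrelevant.
   The initial datum jumps at 0, so x has only a right-hand derivative there
   (the equation starts at 0), and the delayed term t |-> x (t - h) jumps at
   t = h, where x has a corner and the equation holds for the right-hand
   derivative.  Everywhere else the derivative is two-sided.  Continuity on
   [0, +oo) cannot be dropped: right differentiability at h alone does not
   exclude a jump from the left, and uniqueness would fail. *)
Definition is_fundamental_solution (h : R) (x : R -> R) : Prop :=
  x 0 = 1 /\
  (forall s : R, - h <= s < 0 -> x s = 0) /\
  continuous_on (fun t : R => 0 <= t) x /\
  (forall t : R, 0 < t -> t <> h -> is_derive x t (- x t - x (t - h))) /\
  (forall t : R, t = 0 \/ t = h -> is_right_derive x t (- x t - x (t - h))).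

(* Main.v *)
Require Import Defs.
From Stdlib Require Import Reals Lra.
From Coquelicot Require Import Coquelicot.

Open Scope R_scope.

(* The energy V(t) = x(t)^2 + int_{t-h}^t x^2 satisfies V' = - x'^2.  Since
   x(t) + x(t-h) = - x'(t) is small, x is nearly antiperiodic on [t-h, t], and
   the Wirtinger inequality for antiperiodic functions bounds int x^2 by about
   (h / PI)^2 int x'^2 over this window.  Hence V decays by a factor of about
   1 - (PI / h)^2 per delay, i.e. at rate nearly PI^2 / h^3, and |x| <= sqrt V
   at half that rate; the room between alpha and 2 absorbs the errors. *)

(** * Monotonicity from the sign of the derivative *)

(** Differentiability is asked only in the open interval because the solution has corners at [0] and
    [h], where later arguments start. *)
Lemma is_derive_nonneg_le (F F' : R -> R) (a b : R) :
  a <= b ->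
  (forall s, a < s < b -> is_derive F s (F' s)) ->
  (forall s, a <= s <= b -> continuity_pt F s) ->
  (forall s, a < s < b -> 0 <= F' s) -> F a <= F b.
Proof.
  intros Hab Hd Hc Hp.
  destruct (Req_dec a b) as [->|Hne]; [lra|].
  (* The intermediate point may be an endpoint, where nothing is known about [F']; truncating at [0]
     gives the sign there too. *)
  destruct (MVT_gen F a b (fun s => Rmax 0 (F' s))) as [c [_ Hc']].
  - rewrite Rmin_left, Rmax_right by lra.
    intros s Hs; rewrite Rmax_right by (apply Hp, Hs); apply Hd, Hs.
  - rewrite Rmin_left, Rmax_right by lra; exact Hc.
  - assert (0 <= Rmax 0 (F' c)) by apply Rmax_l; nra.
Qed.

Lemma is_derive_continuity_pt (F : R -> R) (s l : R) :
  is_derive F s l -> continuity_pt F s.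
Proof.
  intros H; apply continuity_pt_filterlim.
  apply (ex_derive_continuous F s); exists l; exact H.
Qed.

Lemma is_derive_nonneg_le_closed (F F' : R -> R) (a b : R) :
  a <= b ->
  (forall s, a <= s <= b -> is_derive F s (F' s)) ->
  (forall s, a <= s <= b -> 0 <= F' s) -> F a <= F b.
Proof.
  intros Hab Hd Hp; apply (is_derive_nonneg_le F F'); auto.
  - intros s Hs; apply Hd; lra.
  - intros s Hs; apply (is_derive_continuity_pt _ _ (F' s)), Hd, Hs.
  - intros s Hs; apply Hp; lra.
Qed.

Ltac derive_with :=
  auto_derive;
  [ repeat split; try (eexists; eassumption); auto
  | repeat match goal with
    | H : is_derive ?f ?x ?l |- context [Derive _ ?x] =>
        replace (Derive (fun y => f y) x) with l by (symmetry; apply is_derive_unique; exact H); clear H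
    end ].

(** * Wirtinger inequality for antiperiodic functions *)

(* With w = k cot(k s + phi), which solves w' = - w^2 - k^2, one has
   z^2 - k^2 g^2 - (w g^2)' = (z - w g)^2 when g' = z. *)
Lemma cot_multiplier (g z G Z : R -> R) (k phi a b : R) :
  a <= b ->
  (forall s, a <= s <= b -> is_derive g s (z s)) ->
  (forall s, a <= s <= b -> is_derive G s (g s ^ 2)) ->
  (forall s, a <= s <= b -> is_derive Z s (z s ^ 2)) ->
  (forall s, a <= s <= b -> sin (k * s + phi) <> 0) ->
  k * (cos (k * b + phi) / sin (k * b + phi)) * g b ^ 2
    - k * (cos (k * a + phi) / sin (k * a + phi)) * g a ^ 2
  <= Z b - Z a - k ^ 2 * (G b - G a).
Proof.
  intros Hab Hg HG HZ Hs.
  set (w := fun s => k * (cos (k * s + phi) / sin (k * s + phi))).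
  cut (Z a - k ^ 2 * G a - w a * g a ^ 2 <= Z b - k ^ 2 * G b - w b * g b ^ 2);
    [unfold w; lra|].
  apply (is_derive_nonneg_le_closed
    (fun s => Z s - k ^ 2 * G s - w s * g s ^ 2)
    (fun s => (z s - w s * g s) ^ 2)); auto.
  - intros s Hi; unfold w.
    specialize (Hg s Hi); specialize (HG s Hi); specialize (HZ s Hi);
      specialize (Hs s Hi).
    derive_with.
    field; auto.
  - intros s _; apply pow2_ge_0.
Qed.

(* The zero c of g splits the interval.  Shifting the phase of the cotangent by
   +delta to the right of c and by -delta to its left keeps both multipliers
   regular, and as k h + 2 delta = PI they agree at the two endpoints. *)
Lemma wirtinger_antiperiodic (g z G Z : R -> R) (k a h : R) :
  0 < h -> 0 < k -> k * h < PI ->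
  (forall s, a <= s <= a + h -> is_derive g s (z s)) ->
  (forall s, a <= s <= a + h -> is_derive G s (g s ^ 2)) ->
  (forall s, a <= s <= a + h -> is_derive Z s (z s ^ 2)) ->
  g (a + h) = - g a ->
  k ^ 2 * (G (a + h) - G a) <= Z (a + h) - Z a.
Proof.
  intros Hh Hk HkP Hg HG HZ Hanti.
  assert (Hc : exists c, a <= c <= a + h /\ g c = 0).
  { destruct (Rtotal_order (g a) 0) as [Hlt|[Heq|Hgt]].
    - destruct (Ranalysis5.IVT_interv g a (a + h)) as [c Hc]; try lra; [|eauto].
      intros s Hs; apply (is_derive_continuity_pt _ _ _ (Hg s Hs)).
    - exists a; lra.
    - destruct (Ranalysis5.IVT_interv (fun s => - g s) a (a + h)) as [c Hc]; try lra.
      + intros s Hs; apply continuity_pt_opp.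
        apply (is_derive_continuity_pt _ _ _ (Hg s Hs)).
      + exists c; lra. }
  destruct Hc as [c [Hc Hgc]].
  set (d := (PI - k * h) / 2).
  assert (Hr := cot_multiplier g z G Z k (d - k * c) c (a + h)).
  assert (Hl := cot_multiplier g z G Z k (- d - k * c) a c).
  assert (Hd : 0 < d) by (unfold d; lra).
  assert (0 <= k * (c - a) <= k * h) by nra.
  lapply Hr; [clear Hr; intros Hr|lra].
  lapply Hl; [clear Hl; intros Hl|lra].
  assert (Hsr : forall s, c <= s <= a + h -> sin (k * s + (d - k * c)) <> 0).
  { intros s Hs; apply Rgt_not_eq, sin_gt_0; unfold d in *; nra. }
  assert (Hsl : forall s, a <= s <= c -> sin (k * s + (- d - k * c)) <> 0).
  { intros s Hs; apply Rlt_not_eq.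
    replace (k * s + (- d - k * c)) with (- (k * (c - s) + d)) by ring.
    rewrite sin_neg; apply Ropp_lt_gt_0_contravar, sin_gt_0; unfold d in *; nra. }
  assert (Hcot : cos (k * (a + h) + (d - k * c)) / sin (k * (a + h) + (d - k * c))
               = cos (k * a + (- d - k * c)) / sin (k * a + (- d - k * c))).
  { replace (k * (a + h) + (d - k * c)) with (k * a + (- d - k * c) + PI)
      by (unfold d; field).
    rewrite neg_cos, neg_sin; field; apply Hsl; lra. }
  assert (Hr' : _ <= _) by (apply Hr; auto; intros s Hs;
    first [apply Hg | apply HG | apply HZ]; lra).
  assert (Hl' : _ <= _) by (apply Hl; auto; intros s Hs;
    first [apply Hg | apply HG | apply HZ]; lra).
  (* At [c] the boundary terms vanish with [g]; at the two ends the cotangents agree and the squares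
     of [g] are equal, so these terms cancel in the sum. *)
  rewrite Hcot, Hgc, Hanti in Hr'; rewrite Hgc in Hl'.
  lra.
Qed.

(** * Energy estimate on one delay window *)

(** Subtracting [r / 2] from [f] makes it antiperiodic, so Wirtinger applies with [k h = p PI < PI].
    Young's inequality with parameter [eta] then returns from [g] to [f], at the price of the terms
    in [r ^ 2]. *)
Lemma window_energy_le (f z A Y Z : R -> R) (p eta a h : R) :
  0 < h -> 0 < p < 1 -> 0 < eta ->
  (forall s, a <= s <= a + h -> is_derive f s (z s)) ->
  (forall s, a <= s <= a + h -> is_derive A s (f s ^ 2)) ->
  (forall s, a <= s <= a + h -> is_derive Y s (f s)) ->
  (forall s, a <= s <= a + h -> is_derive Z s (z s ^ 2)) ->
  f (a + h) ^ 2 + (A (a + h) - A a) <=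
    ((1 + eta) * h ^ 2 / (p * PI) ^ 2 + h / 2) * (Z (a + h) - Z a)
    + ((1 + / eta) * h / 4 + / 2) * (f a + f (a + h)) ^ 2.
Proof.
  intros Hh Hp Heta Hf HA HY HZ.
  assert (HPI := PI_RGT_0).
  set (r := f a + f (a + h)).
  set (g := fun s => f s - r / 2).
  set (G := fun s => A s - r * Y s + r ^ 2 / 4 * s).
  set (D := Z (a + h) - Z a).
  assert (Hg : forall s, a <= s <= a + h -> is_derive g s (z s)).
  { intros s Hs; specialize (Hf s Hs); unfold g; derive_with; ring. }
  assert (HG : forall s, a <= s <= a + h -> is_derive G s (g s ^ 2)).
  { intros s Hs; specialize (HA s Hs); specialize (HY s Hs).
    unfold G, g; derive_with; field. }
  set (k := p * PI / h).
  assert (HW : k ^ 2 * (G (a + h) - G a) <= D).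
  { apply (wirtinger_antiperiodic g z G Z); auto.
    - unfold k; apply Rdiv_lt_0_compat; nra.
    - unfold k; replace (p * PI / h * h) with (p * PI) by (field; lra); nra.
    - unfold g, r; lra. }
  assert (HGD : G (a + h) - G a <= h ^ 2 / (p * PI) ^ 2 * D).
  { replace (G (a + h) - G a)
      with (h ^ 2 / (p * PI) ^ 2 * (k ^ 2 * (G (a + h) - G a)))
      by (unfold k; field; lra).
    apply Rmult_le_compat_l; [|exact HW].
    apply Rlt_le, Rdiv_lt_0_compat; apply pow_lt; nra. }
  assert (HAG : A (a + h) - A a
    <= (1 + eta) * (G (a + h) - G a) + (1 + / eta) * (r ^ 2 / 4) * h).
  { set (F := fun s => (1 + eta) * G s + (1 + / eta) * (r ^ 2 / 4) * s - A s).
    cut (F a <= F (a + h)); [unfold F; lra|].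
    apply (is_derive_nonneg_le_closed F
      (fun s => (eta * g s - r / 2) ^ 2 / eta)); [lra| |].
    - intros s Hs; specialize (HG s Hs); specialize (HA s Hs).
      unfold F; derive_with; unfold g; field; lra.
    - intros s _; apply Rmult_le_pos; [apply pow2_ge_0|].
      apply Rlt_le, Rinv_0_lt_compat, Heta. }
  (* Cauchy-Schwarz: by antiperiodicity [z] has integral [2 * g (a + h)] over the window, so [m] is
     its mean, and the integral of [(z - m) ^ 2] is nonnegative. *)
  assert (Hgb : g (a + h) ^ 2 <= h * D / 4).
  { set (m := 2 * g (a + h) / h).
    set (F := fun s => Z s - 2 * m * g s + m ^ 2 * s).
    assert (HF : F a <= F (a + h)).
    { apply (is_derive_nonneg_le_closed F (fun s => (z s - m) ^ 2)); [lra| |].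
      - intros s Hs; specialize (Hg s Hs); specialize (HZ s Hs).
        unfold F; derive_with; ring.
      - intros s _; apply pow2_ge_0. }
    assert (Ha : g a = - g (a + h)) by (unfold g, r; lra).
    unfold F in HF; rewrite Ha in HF.
    assert (Hm : g (a + h) = m * h / 2) by (unfold m; field; lra).
    rewrite Hm in HF |- *; fold D in HF.
    assert (m ^ 2 * h <= D) by (unfold D; lra).
    nra. }
  assert (Hfb : f (a + h) ^ 2 <= 2 * g (a + h) ^ 2 + r ^ 2 / 2).
  { replace (f (a + h)) with (g (a + h) + r / 2) by (unfold g; ring).
    assert (0 <= (g (a + h) - r / 2) ^ 2) by apply pow2_ge_0; lra. }
  assert ((1 + eta) * (G (a + h) - G a)
    <= (1 + eta) * (h ^ 2 / (p * PI) ^ 2 * D)) by (apply Rmult_le_compat_l; lra).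
  unfold Rdiv in *; lra.
Qed.

(** * Removal of the initial jump and an a priori bound *)

(* y replaces the history of x on [-h, 0) by 1, which removes the jump at 0. *)
Lemma fundamental_solution_extension (h : R) (x : R -> R) :
  0 < h -> is_fundamental_solution h x ->
  exists y : R -> R,
    (forall t, 0 <= t -> y t = x t) /\
    (forall t, t <= 0 -> y t = 1) /\
    (forall t, continuity_pt y t) /\
    (forall t, 0 < t < h -> is_derive y t (- y t)) /\
    (forall t, h < t -> is_derive y t (- y t - y (t - h))).
Proof.
  intros Hh (H0 & Hneg & Hc & Hd & _).
  assert (Hy : forall t, 0 < t -> locally t (fun s => x s = x (Rmax 0 s))).
  { intros t Ht; exists (mkposreal t Ht); intros s Hs.
    apply Rabs_def2 in Hs; change (minus s t) with (s - t) in Hs; simpl in Hs.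
    rewrite Rmax_right; [reflexivity|lra]. }
  exists (fun t => x (Rmax 0 t)); refine (conj _ (conj _ (conj _ (conj _ _)))).
  - intros t Ht; rewrite Rmax_right; auto.
  - intros t Ht; rewrite Rmax_left; auto.
  - intros t; apply continuity_pt_filterlim.
    (* [Rmax 0] does not increase distances and takes values in the half-line, so continuity of [x]
       within that half-line suffices. *)
    assert (Hm : filterlim (Rmax 0) (locally t)
                   (within (fun s => 0 <= s) (locally (Rmax 0 t)))).
    { intros P [e He]; exists e; intros s Hs; apply He; [|apply Rmax_l].
      apply Rabs_def2 in Hs; change (minus s t) with (s - t) in Hs.
      apply Rabs_def1; change (minus (Rmax 0 s) (Rmax 0 t)) with (Rmax 0 s - Rmax 0 t);
        unfold Rmax; destruct (Rle_dec 0 s), (Rle_dec 0 t); lra. }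
    apply (filterlim_comp _ _ _ _ _ _ _ _ Hm), Hc, Rmax_l.
  - intros t Ht; apply (is_derive_ext_loc x); [apply Hy; lra|].
    replace (- x (Rmax 0 t)) with (- x t - x (t - h)); [apply Hd; lra|].
    rewrite Rmax_right, (Hneg (t - h)) by lra; ring.
  - intros t Ht; apply (is_derive_ext_loc x); [apply Hy; lra|].
    rewrite !Rmax_right by lra; apply Hd; lra.
Qed.

(** Method of steps: the delayed term has the same coefficient as the damping, so a bound by 1 on
    the past propagates over each further delay. *)
Lemma delay_solution_sq_le_1 (h : R) (y : R -> R) :
  0 < h ->
  (forall t, t <= 0 -> y t = 1) ->
  (forall t, continuity_pt y t) ->
  (forall t, 0 < t < h -> is_derive y t (- y t)) ->
  (forall t, h < t -> is_derive y t (- y t - y (t - h))) ->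
  forall t, y t ^ 2 <= 1.
Proof.
  intros Hh Hneg Hc Hd1 Hd2.
  (* e^t (y^2 - 1) is nonincreasing as long as the forcing term u has |u| <= 1. *)
  assert (step : forall a b, a <= b -> y a ^ 2 <= 1 ->
    (forall s, a < s < b -> exists u, u ^ 2 <= 1 /\ is_derive y s (- y s - u)) ->
    y b ^ 2 <= 1).
  { intros a b Hab Ha Hu.
    set (F := fun s => exp s * (1 - y s ^ 2)).
    assert (HF : F a <= F b).
    { apply (is_derive_nonneg_le F (Derive F)); auto.
      - intros s Hs; destruct (Hu s Hs) as [u [_ Hy]].
        apply Derive_correct; unfold F; auto_derive; eexists; exact Hy.
      - intros s _; unfold F; apply continuity_pt_mult.
        + apply derivable_continuous_pt, derivable_pt_exp.
        + apply continuity_pt_minus; [apply continuity_pt_const; now intros ? ?|].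
          simpl; apply continuity_pt_mult; auto.
          apply continuity_pt_mult; auto; apply continuity_pt_const; now intros ? ?.
      - intros s Hs; destruct (Hu s Hs) as [u [Hu1 Hy]].
        replace (Derive F s) with (exp s * (1 + y s ^ 2 + 2 * y s * u)).
        + apply Rmult_le_pos; [apply Rlt_le, exp_pos|].
          assert (0 <= (y s + u) ^ 2) by apply pow2_ge_0; lra.
        + symmetry; apply is_derive_unique; unfold F; derive_with; ring. }
    unfold F in HF.
    assert (0 <= exp a * (1 - y a ^ 2))
      by (apply Rmult_le_pos; [apply Rlt_le, exp_pos|lra]).
    assert (Hb := exp_pos b); nra. }
  assert (first : forall t, t <= h -> y t ^ 2 <= 1).
  { intros t Ht; destruct (Rle_lt_dec t 0) as [H|H].
    - rewrite Hneg; lra.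
    (* The original history is zero on [[-h, 0)], so the forcing on [(0, h)] is [0], not the value 1
       of the extended history. *)
    - apply (step 0); [lra|rewrite Hneg; lra|].
      intros s Hs; exists 0; split; [lra|].
      rewrite Rminus_0_r; apply Hd1; lra. }
  assert (all : forall n t, t <= (INR n + 1) * h -> y t ^ 2 <= 1).
  { induction n as [|n IH]; intros t Ht; [apply first; simpl in Ht; lra|].
    rewrite S_INR in Ht.
    destruct (Rle_lt_dec t h) as [H|H]; [apply first, H|].
    apply (step h); [lra|apply first; lra|].
    intros s Hs; exists (y (s - h)); split; [apply IH; lra|apply Hd2; lra]. }
  intros t; destruct (Rle_lt_dec t h) as [H|H]; [apply first, H|].
  destruct (nfloor_ex (t / h)) as [n Hn]; [apply Rlt_le, Rdiv_lt_0_compat; lra|].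
  apply (all n).
  apply Rmult_le_reg_r with (/ h); [apply Rinv_0_lt_compat, Hh|].
  rewrite Rmult_assoc, Rinv_r by lra; unfold Rdiv in Hn; lra.
Qed.

(** * Choice of constants *)

(** The choice of [sigma] gives [q / p ^ 2 = 1 - sigma], so the leading term is
    [(1 - sigma ^ 2) / h]. Half of the gap [sigma ^ 2] absorbs the lower-order terms, the other half
    becomes [eps] in the energy. With [PI ^ 2 <= 16] these terms cost at most [24 / h], whence the
    threshold 48. *)
Lemma decay_constants (q h : R) :
  0 < q < 1 ->
  let p := (1 + q) / 2 in
  let sigma := ((1 - q) / (1 + q)) ^ 2 in
  48 / sigma ^ 2 <= h ->
  0 < sigma < 1 /\ 1 <= h /\
  q * PI ^ 2 / h ^ 3 * ((1 + sigma) * h ^ 2 / (p * PI) ^ 2 + h / 2 + 1)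
    <= (1 - sigma ^ 2 / 2) / h /\
  q * PI ^ 2 / h ^ 3 * ((1 + / sigma) * h / 4 + / 2) <= sigma ^ 2 / 2.
Proof.
  intros Hq p sigma Hh.
  assert (HPI := PI_RGT_0); assert (HPI4 := PI_4).
  assert (Hs : 0 < sigma < 1).
  { assert (Hx : 0 < (1 - q) / (1 + q) < 1).
    { split; [apply Rdiv_lt_0_compat; lra|].
      apply Rmult_lt_reg_r with (1 + q); [lra|].
      unfold Rdiv; rewrite Rmult_assoc, Rinv_l; lra. }
    unfold sigma; split; nra. }
  assert (Hsh : 48 <= h * sigma ^ 2).
  { apply Rmult_le_compat_r with (r := sigma ^ 2) in Hh; [|nra].
    unfold Rdiv in Hh; rewrite Rmult_assoc, Rinv_l in Hh; nra. }
  assert (H1 : 48 <= h) by nra.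
  assert (HQ : 0 <= q * PI ^ 2 <= 16) by (split; nra).
  repeat split; try lra.
  - apply Rmult_le_reg_r with h; [lra|].
    replace (_ * h) with ((1 - sigma) * (1 + sigma)
      + q * PI ^ 2 * (/ 2 * / h + (/ h) ^ 2)).
    2:{ replace (1 - sigma) with (q / p ^ 2) by (unfold p, sigma; field; lra).
        field; unfold p; lra. }
    replace ((1 - sigma ^ 2 / 2) / h * h) with (1 - sigma ^ 2 / 2) by (field; lra).
    assert (Hi : 0 < / h) by (apply Rinv_0_lt_compat; lra).
    assert (Hi1 : h * / h = 1) by (apply Rinv_r; lra).
    set (i := / h) in *.
    assert (48 * i <= sigma ^ 2) by nra.
    assert (i <= 1) by nra.
    assert (q * PI ^ 2 * (/ 2 * i + i ^ 2) <= 16 * (/ 2 * i + i)) by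
      (apply Rmult_le_compat; nra).
    lra.
  - assert (Hi : 0 < / h) by (apply Rinv_0_lt_compat; lra).
    assert (Hi1 : h * / h = 1) by (apply Rinv_r; lra).
    assert (Hj : 0 < / sigma) by (apply Rinv_0_lt_compat; lra).
    assert (Hj1 : sigma * / sigma = 1) by (apply Rinv_r; lra).
    replace (q * PI ^ 2 / h ^ 3 * ((1 + / sigma) * h / 4 + / 2))
      with (q * PI ^ 2 * ((1 + / sigma) / 4 * (/ h) ^ 2 + / 2 * (/ h) ^ 3))
      by (field; lra).
    set (i := / h) in *; set (j := / sigma) in *.
    assert (Hi2 : 48 * i <= sigma ^ 2) by nra.
    assert (i <= 1) by nra.
    assert (1 <= j) by nra.
    apply Rle_trans with (16 * (j * i ^ 2)).
    + apply Rmult_le_compat; try lra; [|].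
      * assert (0 <= i ^ 3) by (apply pow_le; lra).
        assert (0 <= (1 + j) / 4 * i ^ 2) by (apply Rmult_le_pos; nra); lra.
      * assert (0 <= i ^ 2) by nra.
        replace (i ^ 3) with (i * i ^ 2) by ring; nra.
    + assert (48 * (j * i) <= sigma).
      { apply Rle_trans with (j * sigma ^ 2); [nra|].
        replace (j * sigma ^ 2) with (sigma * (sigma * j)) by ring; rewrite Hj1; lra. }
      replace (16 * (j * i ^ 2)) with (48 * (j * i) * i / 3) by field.
      assert (48 * (j * i) * i <= sigma * i) by (apply Rmult_le_compat_r; lra).
      nra.
Qed.

(** * Exponential decay of the averaged energy *)

Lemma continuous_antiderivative (f : R -> R) :
  (forall t, continuity_pt f t) -> exists F, forall t, is_derive F t (f t).
Proof.
  intros Hf; exists (RInt f 0); intros t.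
  assert (Hc : forall s, continuous f s)
    by (intros s; apply continuity_pt_filterlim, Hf).
  apply is_derive_RInt with 0; [|apply Hc].
  apply filter_forall; intros s; apply (@RInt_correct R_CompleteNormedModule).
  apply (@ex_RInt_continuous R_CompleteNormedModule); auto.
Qed.

(* The energy V(t) = y(t)^2 + int_{t-h}^t y^2 satisfies V' = - y'^2.
   U averages it over a window (up to the factor 1 - eps, which leaves the term
   - eps y'(t)^2 for the boundary terms of [window_energy_le]), so that U' is
   controlled by the integral of y'^2 over the window. *)
Lemma delay_solution_decay (q h : R) (y : R -> R) :
  0 < q < 1 -> 48 / (((1 - q) / (1 + q)) ^ 2) ^ 2 <= h ->
  (forall t, continuity_pt y t) ->
  (forall t, y t ^ 2 <= 1) ->
  (forall t, h < t -> is_derive y t (- y t - y (t - h))) ->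
  forall t, 3 * h <= t ->
    y t ^ 2 <= 9 * h ^ 2 * exp (- (q * PI ^ 2 / h ^ 3 * (t - 3 * h))).
Proof.
  intros Hq Hh Hc Hy1 Hd.
  destruct (decay_constants q h Hq Hh) as (Hs & Hh1 & HK1 & HK2).
  set (p := (1 + q) / 2) in *; set (sigma := ((1 - q) / (1 + q)) ^ 2) in *.
  set (kappa := q * PI ^ 2 / h ^ 3) in *.
  assert (Hkappa : 0 < kappa).
  { unfold kappa; apply Rdiv_lt_0_compat; [|apply pow_lt; lra].
    apply Rmult_lt_0_compat; [lra|apply pow_lt, PI_RGT_0]. }
  (* Continuous on the whole line, though known to be the derivative of [y] only past [h]; its
     square therefore has a global antiderivative. *)
  set (z := fun s => - y s - y (s - h)).
  assert (Hcz : forall t, continuity_pt z t).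
  { intros t; unfold z; apply continuity_pt_minus; [apply continuity_pt_opp, Hc|].
    apply (continuity_pt_comp (fun s => s - h) y); [|apply Hc].
    apply (is_derive_continuity_pt _ _ 1); auto_derive; auto. }
  assert (Hsq : forall f, (forall t, continuity_pt f t) ->
                forall t, continuity_pt (fun s => f s ^ 2) t).
  { intros f Hf t; simpl; apply continuity_pt_mult; auto.
    apply continuity_pt_mult; auto; apply continuity_pt_const; now intros ? ?. }
  destruct (continuous_antiderivative y Hc) as [Y HY].
  destruct (continuous_antiderivative _ (Hsq y Hc)) as [A HA].
  destruct (continuous_antiderivative _ (Hsq z Hcz)) as [Z HZ].
  destruct (continuous_antiderivative Z) as [B HB].
  { intros t; apply (is_derive_continuity_pt _ _ _ (HZ t)). }
  cbv beta in HA, HZ.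
  assert (HZmono : forall a b, a <= b -> Z a <= Z b).
  { intros a b Hab; apply (is_derive_nonneg_le_closed Z (fun s => z s ^ 2)); auto.
    intros s _; apply pow2_ge_0. }
  (* The middle quantity is the mean over the window of [Z t - Z s], which is [V(s) - V(t)] once the
     window lies past [h]; monotonicity of [Z] bounds it. *)
  assert (HP : forall t,
    0 <= Z t - (B t - B (t - h)) / h <= Z t - Z (t - h)).
  { intros t.
    assert (E1 : h * Z t - h * ((B t - B (t - h)) / h) = h * Z t - (B t - B (t - h)))
      by (field; lra).
    assert (L1 : Z t * (t - h) - B (t - h) <= Z t * t - B t).
    { apply (is_derive_nonneg_le_closed (fun s => Z t * s - B s)
        (fun s => Z t - Z s)); [lra| |].
      - intros s _; assert (HBs := HB s); derive_with; ring.
      - intros s Hs'; assert (Z s <= Z t) by (apply HZmono; lra); lra. }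
    assert (L2 : B (t - h) - Z (t - h) * (t - h) <= B t - Z (t - h) * t).
    { apply (is_derive_nonneg_le_closed (fun s => B s - Z (t - h) * s)
        (fun s => Z s - Z (t - h))); [lra| |].
      - intros s _; assert (HBs := HB s); derive_with; ring.
      - intros s Hs'; assert (Z (t - h) <= Z s) by (apply HZmono; lra); lra. }
    split; nra. }
  set (eps := sigma ^ 2 / 2) in *.
  assert (Heps : 0 < eps < 1) by (unfold eps; nra).
  set (U := fun t => y t ^ 2 + (A t - A (t - h))
                     + (1 - eps) * (Z t - (B t - B (t - h)) / h)).
  set (U' := fun t => - eps * z t ^ 2 - (1 - eps) / h * (Z t - Z (t - h))).
  assert (HU : forall t, h < t -> is_derive U t (U' t)).
  { intros t Ht; unfold U, U'.
    assert (H1 := Hd t Ht); assert (H2 := HA t); assert (H3 := HA (t - h));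
      assert (H4 := HZ t); assert (H5 := HB t); assert (H6 := HB (t - h)).
    unfold Rminus in *.
    derive_with; unfold z, Rminus; field; lra. }
  assert (HUle : forall t, y t ^ 2 <= U t <=
      y t ^ 2 + (A t - A (t - h)) + (Z t - Z (t - h))).
  { intros t; unfold U.
    assert (A (t - h) <= A t).
    { apply (is_derive_nonneg_le_closed A (fun s => y s ^ 2)); auto; [lra|].
      intros s _; apply pow2_ge_0. }
    specialize (HP t); split; nra. }
  (* From [3 * h] on, the whole window lies strictly past [h], where [y' = z]. In the window
     estimate, taken with [eta = sigma], [HK1] pays for the integral of [z ^ 2] and [HK2] for the
     boundary term. *)
  assert (HU' : forall t, 3 * h <= t -> kappa * U t <= - U' t).
  { intros t Ht.
    assert (HW := window_energy_le y z A Y Z p sigma (t - h) h).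
    replace (t - h + h) with t in HW by ring.
    assert (HD : 0 <= Z t - Z (t - h)).
    { assert (Z (t - h) <= Z t) by (apply HZmono; lra); lra. }
    replace ((y (t - h) + y t) ^ 2) with (z t ^ 2) in HW by (unfold z; ring).
    assert (Hz2 : 0 <= z t ^ 2) by apply pow2_ge_0.
    set (D := Z t - Z (t - h)) in *.
    assert (HW' : y t ^ 2 + (A t - A (t - h)) <=
      ((1 + sigma) * h ^ 2 / (p * PI) ^ 2 + h / 2) * D
      + ((1 + / sigma) * h / 4 + / 2) * z t ^ 2).
    { apply HW; auto; try lra; [unfold p; lra|].
      intros s Hs'; apply Hd; lra. }
    clear HW; specialize (HUle t); fold D in HUle.
    assert (HU1 : kappa * U t <= kappa *
      (((1 + sigma) * h ^ 2 / (p * PI) ^ 2 + h / 2 + 1) * D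
      + ((1 + / sigma) * h / 4 + / 2) * z t ^ 2))
      by (apply Rmult_le_compat_l; lra).
    apply Rmult_le_compat_r with (r := D) in HK1; [|exact HD].
    apply Rmult_le_compat_r with (r := z t ^ 2) in HK2; [|exact Hz2].
    unfold U'; fold D; lra. }
  (* From [y ^ 2 <= 1] and [z ^ 2 <= 4] the bound is [1 + 5 * h]; the cruder [9 * h ^ 2] is a
     perfect square. *)
  assert (HU0 : U (3 * h) <= 9 * h ^ 2).
  { apply Rle_trans with (1 := proj2 (HUle (3 * h))).
    assert (A (3 * h) - A (3 * h - h) <= h).
    { cut (3 * h - h - A (3 * h - h) <= 3 * h - A (3 * h)); [lra|].
      apply (is_derive_nonneg_le_closed (fun s => s - A s) (fun s => 1 - y s ^ 2));
        [lra| |].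
      - intros s _; assert (HAs := HA s); derive_with; ring.
      - intros s _; specialize (Hy1 s); lra. }
    assert (Z (3 * h) - Z (3 * h - h) <= 4 * h).
    { cut (4 * (3 * h - h) - Z (3 * h - h) <= 4 * (3 * h) - Z (3 * h)); [lra|].
      apply (is_derive_nonneg_le_closed (fun s => 4 * s - Z s)
        (fun s => 4 - z s ^ 2)); [lra| |].
      - intros s _; assert (HZs := HZ s); derive_with; ring.
      - intros s _; assert (H1 := Hy1 s); assert (H2 := Hy1 (s - h)); unfold z.
        assert (0 <= (y s - y (s - h)) ^ 2) by apply pow2_ge_0; lra. }
    specialize (Hy1 (3 * h)); nra. }
  intros t Ht.
  (* Gronwall: the energy times [exp (kappa * (s - 3 * h))] is nonincreasing. *)
  assert (HE : - (exp (kappa * (3 * h - 3 * h)) * U (3 * h))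
               <= - (exp (kappa * (t - 3 * h)) * U t)).
  { apply (is_derive_nonneg_le_closed
      (fun s => - (exp (kappa * (s - 3 * h)) * U s))
      (fun s => exp (kappa * (s - 3 * h)) * (- U' s - kappa * U s))); [lra| |].
    - intros s Hs'; assert (HUs := HU s); lapply HUs; [clear HUs; intros HUs|lra].
      derive_with; unfold Rminus; ring.
    - intros s Hs'; apply Rmult_le_pos; [apply Rlt_le, exp_pos|].
      assert (kappa * U s <= - U' s) by (apply HU'; lra); lra. }
  rewrite Rminus_diag, Rmult_0_r, exp_0 in HE.
  apply Rle_trans with (1 := proj1 (HUle t)).
  rewrite exp_Ropp.
  assert (He := exp_pos (kappa * (t - 3 * h))).
  apply Rmult_le_reg_l with (1 := He).
  replace (_ * (_ * / _)) with (9 * h ^ 2) by (field; lra).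
  lra.
Qed.

(** * From energy decay to the pointwise bound *)

Theorem theorem8 (v : R -> R -> R)
  (hv : forall h : R, 0 < h -> is_fundamental_solution h (fun t : R => v t h)) :
  forall alpha : R, 2 < alpha ->
  exists h0 c : R, 0 < h0 /\ 0 < c /\
    forall h : R, h0 <= h ->
    forall t : R, 0 <= t ->
      Rabs (v t h) <= c * h * exp (- (PI ^ 2 * t / (alpha * h ^ 3))).
Proof.
  intros alpha Halpha.
  (* The energy rate [q * PI ^ 2 / h ^ 3] is then twice the required rate; the square root halves
     it. *)
  set (q := 2 / alpha).
  assert (Hq : 0 < q < 1).
  { split; [apply Rdiv_lt_0_compat; lra|].
    apply Rmult_lt_reg_r with alpha; [lra|]; unfold q, Rdiv.
    rewrite Rmult_assoc, Rinv_l; lra. }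
  set (h0 := 48 / (((1 - q) / (1 + q)) ^ 2) ^ 2).
  (* The 3 is the root of 9; [exp 24] pays for the time shift by [3 * h], since [3 * PI ^ 2 / (alpha
     * h ^ 2) <= 3 * 16 / 2]. *)
  exists h0, (3 * exp 24).
  assert (Hh0 : 0 < h0).
  { apply Rdiv_lt_0_compat; [lra|]; do 2 apply pow_lt; apply Rdiv_lt_0_compat; lra. }
  assert (He := exp_pos 24).
  split; [exact Hh0|]; split; [lra|]; intros h Hh t Ht.
  assert (Hh1 : 1 <= h) by apply (decay_constants q h Hq Hh).
  destruct (fundamental_solution_extension h (fun t => v t h)) as
    (y & Hyv & Hneg & Hc & Hd1 & Hd2); [lra|apply hv; lra|].
  rewrite <- (Hyv t Ht).
  assert (Hy1 : forall s, y s ^ 2 <= 1)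
    by (apply (delay_solution_sq_le_1 h); auto; lra).
  set (e := PI ^ 2 / (alpha * h ^ 3)).
  assert (Hh3 : 0 < h ^ 3) by (apply pow_lt; lra).
  assert (He0 : 0 < e).
  { apply Rdiv_lt_0_compat; [apply pow_lt, PI_RGT_0|nra]. }
  assert (He24 : e * (3 * h) <= 24).
  { assert (HPI := PI_RGT_0); assert (HPI4 := PI_4).
    replace (e * (3 * h)) with (3 * PI ^ 2 / (alpha * h ^ 2))
      by (unfold e; field; lra).
    apply Rmult_le_reg_r with (alpha * h ^ 2); [nra|].
    unfold Rdiv; rewrite Rmult_assoc, Rinv_l by nra.
    assert (2 * 1 <= alpha * h ^ 2) by (apply Rmult_le_compat; nra); nra. }
  replace (PI ^ 2 * t / (alpha * h ^ 3)) with (e * t) by (unfold e; field; lra).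
  assert (Hmono : forall b, b <= 24 -> exp (b - e * t) <= exp 24 * exp (- (e * t))).
  { intros b Hb; rewrite <- exp_plus.
    destruct (Req_dec b 24) as [->|Hne]; [right; f_equal; ring|].
    left; apply exp_increasing; lra. }
  assert (Hx := exp_pos (- (e * t))).
  rewrite <- (Rabs_pos_eq (_ * h * _)) by
    (apply Rmult_le_pos; [apply Rmult_le_pos; lra|lra]).
  apply Rsqr_le_abs_0; rewrite !Rsqr_pow2.
  destruct (Rle_lt_dec (3 * h) t) as [Hlarge|Hsmall].
  - apply Rle_trans with (1 := delay_solution_decay q h y Hq Hh Hc Hy1 Hd2 t Hlarge).
    specialize (Hmono _ He24).
    replace (9 * h ^ 2 * _) with ((3 * h * exp (e * (3 * h) - e * t)) ^ 2).
    + assert (Hx' := exp_pos (e * (3 * h) - e * t)).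
      apply pow_incr; split; [nra|].
      replace (3 * exp 24 * h * exp (- (e * t)))
        with (3 * h * (exp 24 * exp (- (e * t)))) by ring.
      apply Rmult_le_compat_l; lra.
    + replace (- (q * PI ^ 2 / h ^ 3 * (t - 3 * h)))
        with ((e * (3 * h) - e * t) + (e * (3 * h) - e * t))
        by (unfold q, e; field; lra).
      rewrite exp_plus; ring.
  (* Before [3 * h] the exponent [e * t] is at most 24, so the right-hand side is at least 1 and the
     a priori bound is enough. *)
  - apply Rle_trans with (1 := Hy1 t).
    specialize (Hmono (e * t)); rewrite Rminus_diag, exp_0 in Hmono.
    assert (1 <= exp 24 * exp (- (e * t))) by (apply Hmono; nra).
    assert (1 <= 3 * h * (exp 24 * exp (- (e * t)))) by nra.
    replace (3 * exp 24 * h * exp (- (e * t)))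
      with (3 * h * (exp 24 * exp (- (e * t)))) by ring.
    nra.
Qed.
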